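(* Assume that (i) $\mathcal J:\mathcal X\to[0,+\infty]$ is proper, convex, weakly-* lower semicontinuous with weakly-* sequentially compact non-empty sublevel sets; (ii) $\mathcal H:\mathcal Y\times\mathcal Y\to[0,+\infty]$ is proper, convex in its first argument, weakly-* lower semicontinuous jointly in both arguments, and $\mathcal H(v\mid f)=0$ iff $v=f$; (iii) $A,A^l_n,A^u_n:\mathcal X\to\mathcal Y$ are weak-* to weak-* continuous; (iv) there exists $\mu^\dagger\in\mathcal Y^*\times\mathcal Y^*$, $\mu^\dagger\ge0$, with $p^\dagger:=-B^*\mu^\dagger\in\partial\mathcal J(u^\dagger_{\mathcal J})$; (v) $A^l_n\le A\le A^u_n$ for all $n$, $\|A^u_n-A^l_n\|\le\eta_n\to0$, $\mathcal H(\bar f\mid f_n)\le\delta_n\to0$. For $\alpha>0$ let $(u^\alpha_n,v^\alpha_n)$ solve $$\min_{u\in\mathcal X,\ v\in\mathcal Y}\frac1\alpha\mathcal H(v\mid f_n)+\mathcal J(u)\quad\text{subject to}\quad A^l_nu\le v\le A^u_nu,$$ and let $\alpha_n>0$ be chosen according to the discrepancy principle $$\alpha_n=\sup\{\alpha>0:\mathcal H(v^\alpha_n\mid f_n)\le\tau\delta_n\},\qquad\tau>1,$$ with $v^{\alpha_n}_n$ such that $\mathcal H(v^{\alpha_n}_n\mid f_n)=\tau\delta_n$. Then, with a constant $C$ independent of $n$, $$D^{p^\dagger}_{\mathcal J}(u^{\alpha_n}_n,u^\dagger_{\mathcal J})\le\langle E^*\mu^\dagger,v^{\alpha_n}_n-\bar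 f\rangle+C\eta_n.$$ If, in addition, $\mathcal Y$ is an AM-space with unit $\mathbf 1$ and for every $n$ there exist $u_0\in\operatorname{dom}\mathcal J$, $v_0\in\operatorname{dom}\mathcal H(\cdot\mid f_n)$ and $\varepsilon>0$ with $A^l_nu_0+\varepsilon\mathbf 1\le v_0\le A^u_nu_0-\varepsilon\mathbf 1$, then the same estimate holds for the symmetric Bregman distance $D^{\mathrm{symm}}_{\mathcal J}(u^{\alpha_n}_n,u^\dagger_{\mathcal J})$ corresponding to the subgradients $p^\dagger$ and $p_n=-B_n^*\mu_n\in\partial\mathcal J(u^{\alpha_n}_n)$, where $\mu_n$ solves $\sup_{\mu\in\mathcal Y^*\times\mathcal Y^*,\ \mu\ge0}-\frac1{\alpha_n}\mathcal H^*(\alpha_nE^*\mu\mid f_n)-\mathcal J^*(-B_n^*\mu)$.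
   Context: $\mathcal X=\mathcal U^*$ and $\mathcal Y=\mathcal V^*$ are duals of Banach lattices with the dual norm and dual partial order ($y\ge0$ iff $\langle y,v\rangle\ge0$ for all $v\in\mathcal V$, $v\ge0$); orders on products are componentwise. $A:\mathcal X\to\mathcal Y$ is bounded linear and regular (difference of two positive operators), $A^l_n,A^u_n$ bounded linear, $A^l_n\le A\le A^u_n$ means $A^l_nu\le Au\le A^u_nu$ for all $u\ge0$. $\bar f,f_n\in\mathcal Y$, $\delta_n>0$, and $\tau>1$ does not depend on $n$. $u^\dagger_{\mathcal J}\ge0$ satisfies $Au^\dagger_{\mathcal J}=\bar f$ and $\mathcal J(u^\dagger_{\mathcal J})\le\mathcal J(u)$ whenever $Au=\bar f$. $Bu=(Au,-Au)$, $B_nu=(A^l_nu,-A^u_nu)$, $Ev=(v,-v)$, with adjoints $B^*,B_n^*,E^*$. $\mathcal J^*$ and $\mathcal H^*(\cdot\mid f)$ are convex conjugates (the latter in the first argument). For $p\in\partial\mathcal J(w)$: $D^p_{\mathcal J}(u,w)=\mathcal J(u)-\mathcal J(w)-\langle p,u-w\rangle$; for $q\in\partial\mathcal J(u)$, $p\in\partial\mathcal J(w)$: $D^{\mathrm{symm}}_{\mathcal J}(u,w)=\langle q-p,u-w\rangle$. A Banach lattice is an AM-space if $\|x\vee y\|=\|x\|\vee\|y\|$ for $x,y\ge0$; a unit is $\mathbf 1\ge0$ with $\|\mathbf 1\|=1$ and $\|x\|\le1\Rightarrow|x|\le\mathbf 1$. *)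

(* Defs.v *)
From HB Require Import structures.
From mathcomp Require Import all_boot all_order all_algebra.
From mathcomp Require Import all_classical all_reals all_analysis.
From mathcomp Require Import lra.

Set Implicit Arguments.
Unset Strict Implicit.
Unset Printing Implicit Defensive.

Import Order.TTheory GRing.Theory Num.Theory.
Import numFieldNormedType.Exports.

Local Open Scope classical_set_scope.
Local Open Scope ring_scope.

Reserved Notation "x ≤ y" (at level 70, no associativity).

(* The partial order is carried by the mixin, because Hierarchy Builder does
   not let a structure above NumDomain join Order.POrder and NormedZmodule.
   Meets need no field: the meet of x and y is - joinv (- x) (- y). *)
HB.mixin Record NormedModule_isNormedLattice (R : realType) V
    & NormedModule R V := {
  lev : V -> V -> Prop;
  joinv : V -> V -> V;
  lev_refl : forall x : V, lev x x;
  lev_anti : forall x y : V, lev x y -> lev y x -> x = y;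
  lev_trans : forall y x z : V, lev x y -> lev y z -> lev x z;
  joinvP : forall x y z : V, lev (joinv x y) z <-> lev x z /\ lev y z;
  lev_addr : forall z x y : V, lev x y -> lev (x + z) (y + z);
  scalev_ge0 : forall (a : R) (x : V), 0 <= a -> lev 0 x -> lev 0 (a *: x);
  lev_norm : forall x y : V,
    lev (joinv x (- x)) (joinv y (- y)) -> `|x| <= `|y|
}.

#[short(type="normedLatticeType")]
HB.structure Definition NormedLattice (R : realType) :=
  { V of NormedModule R V & NormedModule_isNormedLattice R V }.

#[short(type="banachLatticeType")]
HB.structure Definition BanachLattice (R : realType) :=
  { V of NormedLattice R V & CompleteNormedModule R V }.

Notation "x ≤ y" := (lev x y) : ring_scope.

Definition absv (R : realType) (V : normedLatticeType R) (x : V) : V :=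
  joinv x (- x).

Section BoundedLinear.
Context {R : realType}.
Implicit Types V W : normedModType R.

Definition boundedLinear_pred V W : pred (V -> W) :=
  fun f => `[< linear f /\ continuous f >].

Record boundedLinear V W := BoundedLinear {
  boundedLinear_fun :> V -> W;
  _ : boundedLinear_pred boundedLinear_fun }.

HB.instance Definition _ V W :=
  [isSub for @boundedLinear_fun V W].
HB.instance Definition _ V W := [Choice of boundedLinear V W by <:].

Lemma boundedLinear_submod V W : submod_closed (@boundedLinear_pred V W).
Proof.
split=> [|a f g].
  apply/asboolP; split=> [a x y|x]; last exact: cvg_cst.
  by rewrite /= scaler0 addr0.
move=> /asboolP[lf cf] /asboolP[lg cg]; apply/asboolP; split=> [b x y|x].
  by rewrite !fctE lf lg !scalerDr !scalerA [b * a]mulrC addrACA.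
by apply: cvgD; [apply: cvgZr; exact: cf|exact: cg].
Qed.

HB.instance Definition _ V W :=
  GRing.isSubmodClosed.Build R (V -> W) (@boundedLinear_pred V W)
    (@boundedLinear_submod V W).

HB.instance Definition _ V W :=
  [SubChoice_isSubLmodule of boundedLinear V W by <:].

Lemma boundedLinear_linear V W (f : boundedLinear V W) : linear f.
Proof. by case: f => f /= /asboolP[]. Qed.

HB.instance Definition _ V W (f : boundedLinear V W) :=
  GRing.isLinear.Build R V W _ (boundedLinear_fun f)
    (@boundedLinear_linear V W f).

Lemma boundedLinear_continuous V W (f : boundedLinear V W) : continuous f.
Proof. by case: f => f /= /asboolP[]. Qed.

Lemma boundedLinearDE V W (f g : boundedLinear V W) x : (f + g) x = f x + g x.
Proof. by []. Qed.
Lemma boundedLinearNE V W (f : boundedLinear V W) x : (- f) x = - f x.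
Proof. by []. Qed.
Lemma boundedLinearZE V W a (f : boundedLinear V W) x : (a *: f) x = a *: f x.
Proof. by []. Qed.
Lemma boundedLinear0E V W x : (0 : boundedLinear V W) x = 0.
Proof. by []. Qed.

Lemma boundedLinearP V W (f g : boundedLinear V W) : f =1 g -> f = g.
Proof. by move=> fg; apply/val_inj/funext. Qed.

Definition opnorm V W (f : boundedLinear V W) : R :=
  sup [set `|f x| | x in [set x : V | `|x| <= 1]].

Lemma opnorm_has_sup V W (f : boundedLinear V W) :
  has_sup [set `|f x| | x in [set x : V | `|x| <= 1]].
Proof.
split; first by exists `|f 0|, 0 => //=; rewrite normr0.
have /linear_boundedP : bounded_near f (nbhs (0 : V)).
  by apply: continuous_linear_bounded; exact: boundedLinear_continuous.
move=> [M [Mreal]] /(_ (`|M| + 1)).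
rewrite (le_lt_trans (ler_norm M)) ?ltrDl// => /(_ isT) Mf.
exists (`|M| + 1) => _ [x /= x1 <-]; apply: le_trans (Mf x) _.
by rewrite ler_piMr// addr_ge0.
Qed.

Lemma opnorm_ge0 V W (f : boundedLinear V W) : 0 <= opnorm f.
Proof.
apply: le_trans (normr_ge0 (f 0)) _; apply: ub_le_sup.
  by have [] := opnorm_has_sup f.
by exists 0 => //=; rewrite normr0.
Qed.

Lemma ler_opnorm V W (f : boundedLinear V W) x : `|f x| <= opnorm f * `|x|.
Proof.
have [->|x0] := eqVneq x 0; first by rewrite linear0 !normr0 mulr0.
have nx0 : 0 < `|x| by rewrite normr_gt0.
rewrite -ler_pdivrMr//.
have -> : `|f x| / `|x| = `|f (`|x|^-1 *: x)|.
  by rewrite linearZ/= normrZ normfV normr_id mulrC.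
apply: ub_le_sup; first by have [] := opnorm_has_sup f.
by exists (`|x|^-1 *: x) => //=; rewrite normrZ normfV normr_id mulVf ?gt_eqF.
Qed.

Lemma opnorm_le V W (f : boundedLinear V W) (M : R) :
  (forall x, `|x| <= 1 -> `|f x| <= M) -> opnorm f <= M.
Proof.
move=> fM; apply: ge_sup; first by have [] := opnorm_has_sup f.
by move=> _ [x /= x1 <-]; exact: fM.
Qed.

Lemma opnormD V W (f g : boundedLinear V W) :
  opnorm (f + g) <= opnorm f + opnorm g.
Proof.
apply: opnorm_le => x x1; rewrite boundedLinearDE.
apply: le_trans (ler_normD _ _) _.
by apply: lerD; apply: le_trans (ler_opnorm _ _) _;
   rewrite ler_piMr// opnorm_ge0.
Qed.

Lemma opnormZ_le V W (a : R) (f : boundedLinear V W) :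
  opnorm (a *: f) <= `|a| * opnorm f.
Proof.
apply: opnorm_le => x x1; rewrite boundedLinearZE normrZ ler_wpM2l//.
by apply: le_trans (ler_opnorm _ _) _; rewrite ler_piMr// opnorm_ge0.
Qed.

Lemma opnorm0_eq0 V W (f : boundedLinear V W) : opnorm f = 0 -> f = 0.
Proof.
move=> f0; apply: boundedLinearP => x; apply/eqP; rewrite -normr_eq0.
by apply/eqP/le_anti; rewrite normr_ge0 andbT -(mul0r `|x|) -f0 ler_opnorm.
Qed.

Lemma opnormZ V W (a : R) (f : boundedLinear V W) :
  opnorm (a *: f) = `|a| * opnorm f.
Proof.
apply/le_anti; rewrite opnormZ_le /=.
have [->|a0] := eqVneq a 0; first by rewrite normr0 mul0r opnorm_ge0.
rewrite mulrC -ler_pdivlMr ?normr_gt0// mulrC -normfV.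
by rewrite -{1}(scale1r f) -(mulVf a0) -scalerA opnormZ_le.
Qed.

HB.instance Definition _ V W := Lmodule_isNormed.Build R (boundedLinear V W)
  (@opnormD V W) (@opnormZ V W) (@opnorm0_eq0 V W).

End BoundedLinear.

Definition dual (R : realType) (V : normedModType R) : Type :=
  boundedLinear V R^o.

HB.instance Definition _ (R : realType) (V : normedModType R) :=
  NormedModule.on (dual V).

Section NormedLatticeTheory.
Context {R : realType} {V : normedLatticeType R}.
Implicit Types x y z : V.

Lemma lev_add2l z x y : x ≤ y -> (z + x) ≤ (z + y).
Proof. by rewrite ![z + _]addrC; exact: lev_addr. Qed.

Lemma lev_add x y z t : x ≤ y -> z ≤ t -> (x + z) ≤ (y + t).
Proof.
by move=> xy zt; apply: (@lev_trans _ _ (y + z)); [exact: lev_addr|exact: lev_add2l].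
Qed.

Lemma subv_ge0 x y : 0 ≤ (y - x) <-> x ≤ y.
Proof.
by split=> [/(lev_addr x)|/(lev_addr (- x))]; rewrite ?add0r ?subrK ?subrr.
Qed.

Lemma addv_ge0 x y : 0 ≤ x -> 0 ≤ y -> 0 ≤ (x + y).
Proof. by move=> x0 y0; have := lev_add x0 y0; rewrite addr0. Qed.

Lemma lev_opp x y : (- x) ≤ (- y) <-> y ≤ x.
Proof.
split=> /subv_ge0 h; apply/subv_ge0; last by rewrite opprK addrC.
by rewrite opprK addrC in h.
Qed.

Lemma lev_joinl x y : x ≤ joinv x y.
Proof. by have /joinvP[] := lev_refl (joinv x y). Qed.

Lemma lev_joinr x y : y ≤ joinv x y.
Proof. by have /joinvP[] := lev_refl (joinv x y). Qed.

Lemma absv_lb x : x ≤ absv x. Proof. exact: lev_joinl. Qed.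
Lemma absv_lbN x : (- x) ≤ absv x. Proof. exact: lev_joinr. Qed.

Lemma absv_ge0 x : 0 ≤ absv x.
Proof.
have : 0 ≤ (absv x + absv x).
  by rewrite -(subrr x); apply: lev_add; [exact: absv_lb|exact: absv_lbN].
have h : 0 <= 2^-1 :> R by rewrite invr_ge0.
have e : 2^-1 + 2^-1 = 1 :> R by rewrite -[2^-1]mul1r -splitr.
by move=> /(scalev_ge0 _ _ h); rewrite scalerDr -scalerDl e scale1r.
Qed.

Lemma ger0_absv x : 0 ≤ x -> absv x = x.
Proof.
move=> x0; apply: lev_anti; last exact: absv_lb.
apply/joinvP; split; first exact: lev_refl.
by apply: lev_trans (_ : 0 ≤ x); rewrite // -[0]oppr0; apply/lev_opp.
Qed.

Lemma absvN x : absv (- x) = absv x.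
Proof.
apply: lev_anti; apply/joinvP; split.
- exact: absv_lbN.
- by rewrite opprK; exact: absv_lb.
- by rewrite -{1}[x]opprK; exact: absv_lbN.
- exact: absv_lb.
Qed.

Lemma norm_absv x : `|absv x| = `|x|.
Proof.
have e : absv (absv x) = absv x by apply: ger0_absv; exact: absv_ge0.
by apply/le_anti/andP; split; apply: lev_norm;
  rewrite -!/(absv _) e; exact: lev_refl.
Qed.

Lemma lev_norm_abs x y : absv x ≤ absv y -> `|x| <= `|y|.
Proof. exact: lev_norm. Qed.

Lemma lev_norm_ge0 x y : 0 ≤ x -> x ≤ y -> `|x| <= `|y|.
Proof.
move=> x0 xy; apply: lev_norm_abs; rewrite !ger0_absv//.
exact: lev_trans xy.
Qed.

Definition posv x : V := joinv x 0.
Definition negv x : V := joinv (- x) 0.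

Lemma posv_ge0 x : 0 ≤ posv x. Proof. exact: lev_joinr. Qed.
Lemma negv_ge0 x : 0 ≤ negv x. Proof. exact: lev_joinr. Qed.

Lemma posvBneg x : posv x - negv x = x.
Proof.
apply/eqP; rewrite subr_eq; apply/eqP/lev_anti.
  apply/joinvP; split.
    by rewrite -{1}[x]addr0; apply: lev_add2l; exact: negv_ge0.
  by rewrite -[0](subrr x); apply: lev_add2l; exact: lev_joinl.
have h : negv x ≤ (posv x - x).
  apply/joinvP; split; last by apply/subv_ge0; exact: lev_joinl.
  by rewrite -{1}[- x]add0r; apply: lev_addr; exact: posv_ge0.
by have := lev_add2l x h; rewrite [x + (_ - _)]addrC subrK.
Qed.

Lemma norm_posv x : `|posv x| <= `|x|.
Proof.
rewrite -(norm_absv x); apply: lev_norm_ge0; first exact: posv_ge0.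
by apply/joinvP; split; [exact: absv_lb|exact: absv_ge0].
Qed.

Lemma norm_negv x : `|negv x| <= `|x|.
Proof. by rewrite -(normrN x); exact: norm_posv. Qed.

Lemma riesz_decomposition y x1 x2 : 0 ≤ x1 -> 0 ≤ x2 ->
  0 ≤ y -> y ≤ (x1 + x2) ->
  exists y1 y2, [/\ y = y1 + y2, 0 ≤ y1 /\ y1 ≤ x1 & 0 ≤ y2 /\ y2 ≤ x2].
Proof.
move=> x10 x20 y0 yx; exists (- joinv (- y) (- x1)), (y + joinv (- y) (- x1)).
split; first by rewrite addrCA addNr addr0.
  split; last by rewrite -{2}[x1]opprK; apply/lev_opp; exact: lev_joinr.
  by rewrite -[0]oppr0; apply/lev_opp/joinvP; split;
    rewrite -[0]oppr0; apply/lev_opp.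
split.
  by rewrite -(subrr y); apply: lev_add2l; exact: lev_joinl.
rewrite -[x2](addKr (- y)) opprK; apply: lev_add2l; apply/joinvP; split.
  by rewrite -{1}[- y]addr0; apply: lev_add2l.
apply/subv_ge0; move: yx => /subv_ge0; congr lev.
by rewrite opprK [RHS]addrC [- y + _]addrC addrA.
Qed.

End NormedLatticeTheory.

Section DualLattice.
Context {R : realType} {V : normedLatticeType R}.
Implicit Types (f g h : dual V) (x y : V).

Definition dual_le f g : Prop := forall x, 0 ≤ x -> (f x : R) <= g x.

Lemma dual_le_refl f : dual_le f f. Proof. by move=> x. Qed.

Lemma dual_le_anti f g : dual_le f g -> dual_le g f -> f = g.
Proof.
move=> fg gf; apply: boundedLinearP => x; rewrite -(posvBneg x) !linearB /=.
by congr (_ - _); apply/le_anti/andP; split;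
  [apply: fg|apply: gf|apply: fg|apply: gf];
  first [exact: posv_ge0|exact: negv_ge0].
Qed.

Lemma dual_le_trans g f h : dual_le f g -> dual_le g h -> dual_le f h.
Proof. by move=> fg gh x x0; apply: le_trans (fg x x0) (gh x x0). Qed.

(* Riesz-Kantorovich formula for the positive part of f, on the positive cone. *)
Definition dual_pos_cone f x : R :=
  sup [set (f y : R) | y in [set y | 0 ≤ y /\ y ≤ x]].

Let pps := dual_pos_cone.

Let ler_dual_norm f x : (f x : R) <= opnorm f * `|x|.
Proof. by apply: le_trans (ler_norm _) _; exact: ler_opnorm. Qed.

Let itv_norm f x y : 0 ≤ y -> y ≤ x -> (f y : R) <= opnorm f * `|x|.
Proof.
move=> y0 yx; apply: le_trans (ler_dual_norm f y) _.
by rewrite ler_wpM2l ?opnorm_ge0//; exact: lev_norm_ge0.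
Qed.

Let pps_has_sup f x : 0 ≤ x ->
  has_sup [set (f y : R) | y in [set y | 0 ≤ y /\ y ≤ x]].
Proof.
move=> x0; split.
  by exists (f 0), 0 => //; split=> //; exact: lev_refl.
by exists (opnorm f * `|x|) => _ [y [y0 yx] <-]; exact: itv_norm.
Qed.

Let pps_ub f x y : 0 ≤ y -> y ≤ x -> (f y : R) <= pps f x.
Proof.
move=> y0 yx; apply: ub_le_sup; last by exists y.
by have [] := pps_has_sup f (lev_trans _ _ _ y0 yx).
Qed.

Let pps_le f x (M : R) : 0 ≤ x ->
  (forall y, 0 ≤ y -> y ≤ x -> (f y : R) <= M) -> pps f x <= M.
Proof.
move=> x0 fM; apply: ge_sup; first by have [] := pps_has_sup f x0.
by move=> _ [y [y0 yx] <-]; exact: fM.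
Qed.

Let pps_ge0 f x : 0 ≤ x -> 0 <= pps f x.
Proof.
by move=> x0; rewrite -(linear0 f); apply: pps_ub => //; exact: lev_refl.
Qed.

Let ppsD f x y : 0 ≤ x -> 0 ≤ y -> pps f (x + y) = pps f x + pps f y.
Proof.
move=> x0 y0; have xy0 := addv_ge0 x0 y0; apply/le_anti/andP; split.
  apply: pps_le => // z z0 zxy.
  have [z1 [z2 [-> [z10 z1x] [z20 z2y]]]] := riesz_decomposition x0 y0 z0 zxy.
  by rewrite linearD; apply: lerD; exact: pps_ub.
rewrite -lerBrDr; apply: pps_le => // z z0 zx.
rewrite lerBrDr -lerBrDl; apply: pps_le => // t t0 ty.
rewrite lerBrDl -linearD; apply: pps_ub; first exact: addv_ge0.
exact: lev_add.
Qed.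

Let ppsZ_le f (a : R) x : 0 < a -> 0 ≤ x -> pps f (a *: x) <= a * pps f x.
Proof.
move=> a0 x0; have ai0 : 0 <= a^-1 by rewrite invr_ge0 ltW.
apply: pps_le; first by apply: scalev_ge0 => //; exact: ltW.
move=> y y0 yax; rewrite mulrC -ler_pdivrMr// mulrC.
have -> : a^-1 * f y = f (a^-1 *: y) by rewrite linearZ.
apply: pps_ub; first exact: scalev_ge0.
apply/subv_ge0; rewrite -[x]scale1r -(mulVf (lt0r_neq0 a0)) -scalerA -scalerBr.
by apply: scalev_ge0 => //; exact/subv_ge0.
Qed.

Let ppsZ f (a : R) x : 0 <= a -> 0 ≤ x -> pps f (a *: x) = a * pps f x.
Proof.
rewrite le_eqVlt => /orP[/eqP <-|a0] x0.
  rewrite scale0r mul0r; apply/le_anti; rewrite pps_ge0 ?andbT; last exact: lev_refl.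
  apply: pps_le => [|y y0 /lev_anti/(_ y0) ->]; first exact: lev_refl.
  by rewrite linear0.
apply/le_anti; rewrite ppsZ_le//= -ler_pdivlMl//.
rewrite -{1}[x]scale1r -(mulVf (lt0r_neq0 a0)) -scalerA ppsZ_le ?invr_gt0//.
by apply: scalev_ge0 => //; exact: ltW.
Qed.

Definition dual_pos_fun f x : R^o := pps f (posv x) - pps f (negv x).

Let ppfE f x y : 0 ≤ x -> 0 ≤ y -> dual_pos_fun f (x - y) = pps f x - pps f y.
Proof.
move=> x0 y0; rewrite /dual_pos_fun; set z := x - y.
have p0 := posv_ge0 z; have n0 := negv_ge0 z.
have e : posv z + y = x + negv z.
  have -> : posv z = z + negv z by rewrite -{2}(posvBneg z) subrK.
  by rewrite addrAC subrK.
have := congr1 (pps f) e; rewrite !ppsD// => pe.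
by apply/eqP; rewrite subr_eq addrAC eq_sym subr_eq pe.
Qed.

Let ppf_linear f : linear (dual_pos_fun f).
Proof.
move=> a x y.
have zE z : dual_pos_fun f z = pps f (posv z) - pps f (negv z) by [].
have p0 := @posv_ge0 R V; have n0 := @negv_ge0 R V.
have sE : dual_pos_fun f (a *: x) = a * dual_pos_fun f x.
  have [a0|a0] := leP 0 a.
    rewrite -{1}(posvBneg x) scalerBr ppfE; try exact: scalev_ge0.
    by rewrite !ppsZ// zE mulrBr.
  have na0 : 0 <= - a by rewrite oppr_ge0 ltW.
  have -> : a *: x = - a *: negv x - - a *: posv x.
    by rewrite -{1}(posvBneg x) scalerBr !scaleNr opprK addrC.
  rewrite ppfE; try exact: scalev_ge0.
  by rewrite !ppsZ// zE mulrBr !mulNr opprK addrC.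
have dE u v : dual_pos_fun f (u + v) = dual_pos_fun f u + dual_pos_fun f v.
  have -> : u + v = posv u + posv v - (negv u + negv v).
    by rewrite opprD addrACA !posvBneg.
  rewrite ppfE; try exact: addv_ge0.
  by rewrite !ppsD// !zE opprD addrACA.
by rewrite dE sE.
Qed.

Let pps_norm f x : 0 ≤ x -> pps f x <= opnorm f * `|x|.
Proof. by move=> x0; apply: pps_le => // y; exact: itv_norm. Qed.

Let ppf_norm f x : `|dual_pos_fun f x| <= opnorm f * `|x| *+ 2.
Proof.
apply: le_trans (ler_normB _ _) _.
rewrite !ger0_norm ?pps_ge0//; [|exact: negv_ge0|exact: posv_ge0].
rewrite mulr2n; apply: lerD.
  apply: le_trans (pps_norm f (posv_ge0 x)) _.
  by rewrite ler_wpM2l ?opnorm_ge0//; exact: norm_posv.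
apply: le_trans (pps_norm f (negv_ge0 x)) _.
by rewrite ler_wpM2l ?opnorm_ge0//; exact: norm_negv.
Qed.

Let ppf_continuous f : continuous (dual_pos_fun f).
Proof.
pose p : {linear V -> R^o} := HB.pack (dual_pos_fun f)
  (GRing.isLinear.Build _ _ _ _ _ (@ppf_linear f)).
suff : continuous p by [].
apply/linear_bounded_continuous/linear_boundedP.
near=> r => x /=; apply: le_trans (ppf_norm f x) _.
by rewrite -mulrnAl ler_wpM2r.
Unshelve. all: by end_near. Qed.

Lemma dual_pos_subproof f : boundedLinear_pred (dual_pos_fun f).
Proof. by apply/asboolP; split; [exact: ppf_linear|exact: ppf_continuous]. Qed.

Definition dual_pos f : dual V := BoundedLinear (dual_pos_subproof f).

Let dual_posE f x : 0 ≤ x -> dual_pos f x = pps f x :> R.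
Proof.
move=> x0; rewrite -{1}[x]subr0 /= ppfE//; last exact: lev_refl.
by rewrite -(scale0r (0 : V)) ppsZ ?mul0r ?subr0//; exact: lev_refl.
Qed.

Lemma dual_posP f h : dual_le (dual_pos f) h <-> dual_le f h /\ dual_le 0 h.
Proof.
split=> [fh|[fh h0] x x0].
  split=> x x0; apply: le_trans (fh x x0); rewrite dual_posE//.
    by apply: pps_ub => //; exact: lev_refl.
  exact: pps_ge0.
rewrite dual_posE//; apply: pps_le => // y y0 yx.
apply: le_trans (fh y y0) _; rewrite -subr_ge0.
have : 0 ≤ (x - y) by apply/subv_ge0.
by move=> /h0; rewrite boundedLinear0E linearB.
Qed.

Lemma dual_le_add h f g : dual_le f g -> dual_le (f + h) (g + h).
Proof. by move=> fg x x0; rewrite !boundedLinearDE lerD2r fg. Qed.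

Definition dual_join f g : dual V := g + dual_pos (f - g).

Lemma dual_joinP f g h :
  dual_le (dual_join f g) h <-> dual_le f h /\ dual_le g h.
Proof.
have E u v w : dual_le (u + v) w <-> dual_le v (w - u).
  split=> [/(dual_le_add (- u))|/(dual_le_add u)].
    by rewrite addrAC subrr add0r.
  by rewrite subrK addrC.
have E0 : dual_le 0 (h - g) <-> dual_le g h by rewrite -E addr0.
have E1 : dual_le (f - g) (h - g) <-> dual_le f h by rewrite -E addrC subrK.
by rewrite E dual_posP E0 E1.
Qed.

Lemma dual_scale_ge0 (a : R) f : 0 <= a -> dual_le 0 f -> dual_le 0 (a *: f).
Proof.
move=> a0 f0 x x0; rewrite boundedLinearZE boundedLinear0E.
by apply: mulr_ge0 => //; exact: f0.
Qed.

Let ler_half_sum (p q r s : R) :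
  p + q <= r + s -> - (p - q) <= r - s -> q <= r.
Proof. by lra. Qed.

Lemma dual_lev_norm f g :
  dual_le (dual_join f (- f)) (dual_join g (- g)) -> `|f| <= `|g|.
Proof.
move=> fg; apply: opnorm_le => x x1.
have /dual_joinP[f1 f2] := dual_le_refl (dual_join f (- f)).
have fF (F : dual V) z a : dual_le f F -> dual_le (- f) F ->
    z ≤ a -> (- z) ≤ a -> (f z : R) <= F a.
  move=> {}f1 {}f2 za nza.
  have h1 : (f (a - (- z)) : R) <= F (a - (- z)).
    by apply: f1; apply/subv_ge0.
  have h2 : - (f (a - z) : R) <= F (a - z).
    by have := f2 (a - z); rewrite boundedLinearNE; apply; apply/subv_ge0.
  rewrite opprK (linearD f) (linearD F) in h1.
  rewrite (linearB f) (linearB F) in h2.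
  exact: ler_half_sum h1 h2.
have fx : `|f x| <= dual_join f (- f) (absv x) :> R.
  rewrite ler_norml lerNl -linearN.
  apply/andP; split; apply: fF => //; rewrite ?opprK.
  - exact: absv_lbN.
  - exact: absv_lb.
  - exact: absv_lb.
  - exact: absv_lbN.
apply: le_trans fx _; apply: le_trans (fg _ (absv_ge0 x)) _.
have -> : dual_join g (- g) (absv x) = pps (g - - g) (absv x) - g (absv x) :> R.
  by rewrite addrC -dual_posE//; exact: absv_ge0.
rewrite lerBlDr.
apply: pps_le; first exact: absv_ge0.
move=> y y0 yx; rewrite opprK boundedLinearDE -lerBlDr -linearD -linearB.
apply: le_trans (ler_norm _) _; apply: le_trans (ler_opnorm _ _) _.
rewrite ler_piMr ?opnorm_ge0//; apply: le_trans x1.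
rewrite -(norm_absv x); apply: lev_norm_abs; rewrite [absv (absv x)]ger0_absv.
  apply/joinvP; split.
    rewrite -addrA -[X in _ ≤ X]addr0; apply: lev_add => //.
    by rewrite -[0](subrr (absv x)); apply: lev_addr.
  rewrite opprB -[X in _ ≤ X]subr0; apply: lev_add2l; apply/lev_opp.
  exact: addv_ge0.
exact: absv_ge0.
Qed.

HB.instance Definition _ := NormedModule_isNormedLattice.Build R (dual V)
  dual_le_refl dual_le_anti dual_le_trans dual_joinP dual_le_add
  dual_scale_ge0 dual_lev_norm.

End DualLattice.

Section Operators.
Context {R : realType}.
Implicit Types V W Z : normedModType R.

Lemma id_boundedLinear_subproof V : boundedLinear_pred (@id V).
Proof. by apply/asboolP; split=> // x. Qed.

Definition idop V : boundedLinear V V :=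
  BoundedLinear (@id_boundedLinear_subproof V).

Lemma pair_boundedLinear_subproof V W Z
    (S : boundedLinear V W) (T : boundedLinear V Z) :
  boundedLinear_pred (fun x => (S x, T x)).
Proof.
apply/asboolP; split=> [a x y|x]; first by rewrite !linearP.
by apply: cvg_pair; exact: boundedLinear_continuous.
Qed.

Definition pairop V W Z (S : boundedLinear V W) (T : boundedLinear V Z) :
    boundedLinear V (W * Z)%type :=
  BoundedLinear (pair_boundedLinear_subproof S T).

Lemma adjoint_boundedLinear_subproof V W (T : boundedLinear V W)
    (g : dual W) : boundedLinear_pred (fun x => g (T x)).
Proof.
apply/asboolP; split=> [a x y|x]; first by rewrite !linearP.
by apply: continuous_comp; exact: boundedLinear_continuous.
Qed.

Definition adjoint V W (T : boundedLinear V W) (g : dual W) : dual V :=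
  BoundedLinear (adjoint_boundedLinear_subproof T g).

Lemma dual_pair_subproof V W (mu : dual V * dual W) :
  boundedLinear_pred (fun x : V * W => mu.1 x.1 + mu.2 x.2 : R^o).
Proof.
apply/asboolP; split=> [a x y|x].
  by rewrite /= !linearP scalerDr addrACA.
by apply: cvgD; apply: continuous_comp;
  [exact: cvg_fst|exact: boundedLinear_continuous
  |exact: cvg_snd|exact: boundedLinear_continuous].
Qed.

(* The identification of V* x W* with (V x W)*. *)
Definition dual_pair V W (mu : dual V * dual W) : dual (V * W)%type :=
  BoundedLinear (dual_pair_subproof mu).

End Operators.

Section WeakStar.
Context {R : realType}.

Definition weakstar (V : normedModType R) : Type :=
  initial_topology (fun f : dual V => (f : V -> R^o) : {ptws V -> R^o}).

HB.instance Definition _ (V : normedModType R) := Topological.on (weakstar V).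

End WeakStar.

Definition seq_compact (T : topologicalType) (S : set T) : Prop :=
  forall x : nat -> T, (forall k, S (x k)) ->
  exists2 s : nat -> nat, {homo s : m n / (m < n)%N} &
    exists2 l, S l & x (s k) @[k --> \oo] --> l.

Section Order.
Context {R : realType}.
Implicit Types X Y : normedLatticeType R.

Definition positive_op X Y (T : X -> Y) : Prop := forall u, 0 ≤ u -> 0 ≤ T u.

Definition regular_op X Y (T : X -> Y) : Prop :=
  exists P Q : {linear X -> Y},
    [/\ positive_op P, positive_op Q & forall u, T u = P u - Q u].

Definition op_le X Y (S T : X -> Y) : Prop := forall u, 0 ≤ u -> S u ≤ T u.

Definition AM_space Y : Prop :=
  forall x y : Y, 0 ≤ x -> 0 ≤ y -> `|joinv x y| = Num.max `|x| `|y|.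

Definition lattice_unit Y (one : Y) : Prop :=
  [/\ 0 ≤ one, `|one| = 1 & forall x : Y, `|x| <= 1 -> absv x ≤ one].

End Order.

Section ConvexAnalysis.
Context {R : realType} {V : normedModType R}.
Local Open Scope ereal_scope.
Implicit Types (F : V -> \bar R) (p q : dual V) (u w : V).

Definition effdom (T : Type) (F : T -> \bar R) : set T := [set x | F x < +oo].

Definition proper_fun (T : Type) (F : T -> \bar R) : Prop :=
  (forall x, F x != -oo) /\ effdom F !=set0.

Definition convex_efun F : Prop := forall (t : R) u w, (0 <= t <= 1)%R ->
  F (t *: u + (1 - t) *: w)%R <= t%:E * F u + (1 - t)%:E * F w.

Definition conjugate F p : \bar R :=
  ereal_sup [set (p u : R)%:E - F u | u in setT].

Definition subdifferential F w : set (dual V) :=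
  [set p | F w \is a fin_num /\
           forall u, F w + (p (u - w)%R : R)%:E <= F u].

Definition bregman F p u w : \bar R := F u - F w - (p (u - w)%R : R)%:E.

(* q and p are the chosen subgradients of the underlying functional at u and w
   respectively; the functional enters only through them. *)
Definition symm_bregman q p u w : R := (q - p)%R (u - w)%R.

End ConvexAnalysis.

Section Problem.
Context {R : realType} {X Y : normedLatticeType R}.
Implicit Types (J : X -> \bar R) (H : Y -> Y -> \bar R) (f : Y) (alpha : R).
Implicit Types (A Al Au : boundedLinear X Y) (mu : dual Y * dual Y).

Definition opB A : boundedLinear X (Y * Y)%type := pairop A (- A).

Definition opBn Al Au : boundedLinear X (Y * Y)%type := pairop Al (- Au).

Definition opE : boundedLinear Y (Y * Y)%type := pairop (idop Y) (- idop Y).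

Definition nonneg_pair mu : Prop := 0 ≤ mu.1 /\ 0 ≤ mu.2.

Definition primal_feasible Al Au (u : X) (v : Y) : Prop :=
  Al u ≤ v /\ v ≤ Au u.

Definition primal_objective H J f alpha (u : X) (v : Y) : \bar R :=
  ((alpha^-1)%:E * H v f + J u)%E.

Definition primal_solution H J f Al Au alpha (u : X) (v : Y) : Prop :=
  primal_feasible Al Au u v /\
  forall u' v', primal_feasible Al Au u' v' ->
    (primal_objective H J f alpha u v <= primal_objective H J f alpha u' v')%E.

Definition dual_objective H J f Al Au alpha mu : \bar R :=
  (- ((alpha^-1)%:E *
      conjugate (H ^~ f) (alpha *: adjoint opE (dual_pair mu))%R)
   - conjugate J (- adjoint (opBn Al Au) (dual_pair mu))%R)%E.

Definition dual_solution H J f Al Au alpha mu : Prop :=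
  nonneg_pair mu /\
  forall mu', nonneg_pair mu' ->
    (dual_objective H J f Al Au alpha mu' <=
     dual_objective H J f Al Au alpha mu)%E.

Definition slater_condition H J f Al Au (one : Y) : Prop :=
  exists (u0 : X) (v0 : Y) (eps : R),
    [/\ effdom J u0, effdom (H ^~ f) v0, 0 < eps,
        (Al u0 + eps *: one) ≤ v0 & v0 ≤ (Au u0 - eps *: one)].

End Problem.

(* Main.v *)
Require Import Defs.
From HB Require Import structures.
From mathcomp Require Import all_boot all_order all_algebra.
From mathcomp Require Import all_classical all_reals all_analysis.
From mathcomp Require Import ring lra.

(** The regularised solution is compared with the pair (udag, fbar), which is
feasible because udag is nonnegative and A lies between the two bounding
operators. Together with the discrepancy principle, minimality gives
J (u_n) <= J udag, so the u_n stay in one sublevel set of J. Such a set is weak*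
sequentially compact, hence norm bounded by the uniform boundedness principle
([seq_compact_weakstar_bounded]).

By the source condition pdag = - B^* mudag, the nonpositive difference
J (u_n) - J udag may be dropped from the Bregman distance, which leaves
<mudag, B (u_n - udag)>. Replacing A u_n by v_n here costs <mudag, E (A u_n - v_n)>,
and v_n lies between the lower and the upper image of u_n; since mudag is
nonnegative, the cost is at most |mudag| |Au - Al| |u_n| ([opB_gap]). The u_n need
not be nonnegative, and it is monotonicity of the operator norm on positive
operators ([op_interval_norm]) that controls A - Al and Au - A by Au - Al.

For the symmetric distance it remains to see that <p_n, u_n - udag> <= 0. This is
convex duality. The value of the primal problem with relaxed constraints is a
convex function of the relaxation, bounded above near 0 by the Slater condition
because the order unit puts a norm ball inside an order interval. Such a function
has a continuous subgradient at 0 ([convex_subgradient]), obtained from the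
Hahn-Banach theorem ([hahn_banach]); its opposite is a nonnegative multiplier, and
there is no duality gap ([strong_duality]). So every dual solution mu bounds the
Lagrangian from below by the primal value. Evaluating that bound at (u, v_n) shows
that p_n is a subgradient of J at u_n, and evaluating it at (u_n, fbar), where
H (fbar | f_n) <= tau delta_n = H (v_n | f_n), gives the sign of <p_n, u_n - udag>. *)

Set Implicit Arguments.
Unset Strict Implicit.
Unset Printing Implicit Defensive.

Import Order.TTheory GRing.Theory Num.Theory.
Import numFieldNormedType.Exports.

Local Open Scope classical_set_scope.
Local Open Scope ring_scope.

(** * Hahn-Banach theorem for sublinear functionals *)

Section HahnBanach.
Context {R : realType} {E : lmodType R}.
Implicit Types (p q : E -> R) (x y : E).

(** Homogeneity is only asked as an inequality; [sublinearZ] recovers equality by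
applying it to the inverse scalar. *)
Definition sublinear p : Prop :=
  (forall x y, p (x + y) <= p x + p y) /\
  (forall a x, 0 < a -> p (a *: x) <= a * p x).

Lemma sublinear0 p : sublinear p -> p 0 = 0.
Proof.
move=> [pD pZ]; have := pD 0 0; rewrite addr0 => h1.
have := pZ 2^-1 0; rewrite invr_gt0 ltr0n scaler0 => /(_ isT) h2.
by apply/le_anti/andP; split; lra.
Qed.

Lemma sublinearZ p a x : sublinear p -> 0 <= a -> p (a *: x) = a * p x.
Proof.
move=> sp; rewrite le_eqVlt => /orP[/eqP <-|a0].
  by rewrite scale0r mul0r sublinear0.
apply/le_anti; rewrite sp.2//= -ler_pdivlMl//.
rewrite -{1}[x]scale1r -(mulVf (lt0r_neq0 a0)) -scalerA.
by apply: sp.2; rewrite invr_gt0.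
Qed.

Lemma sublinear_geN p x : sublinear p -> - p (- x) <= p x.
Proof.
by move=> sp; rewrite -subr_ge0 opprK -(sublinear0 sp) -(subrr x); exact: sp.1.
Qed.

(** The last hypothesis lets one member of the family serve two arguments at once,
as happens along a chain. Finiteness of the infimum comes from [sublinear_geN]: all
members are bounded below by - q (- x). *)
Lemma sublinear_inf (A : set (E -> R)) q : A !=set0 ->
  (forall p, A p -> sublinear p /\ forall x, p x <= q x) ->
  (forall p1 p2, A p1 -> A p2 -> exists2 p, A p & forall x y,
     p (x + y) <= p1 x + p2 y) ->
  sublinear (fun x => inf [set p x | p in A]) /\
  (forall p x, A p -> inf [set p x | p in A] <= p x).
Proof.
move=> A0 Aq AD.
have infle p x : A p -> inf [set p x | p in A] <= p x.
  move=> Ap; apply: ge_inf; last by exists p.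
  exists (- q (- x)) => _ [r /Aq[sr rq] <-].
  by apply: le_trans (sublinear_geN x sr); rewrite lerN2.
have leinf x z : (forall p, A p -> z <= p x) -> z <= inf [set p x | p in A].
  move=> zA; apply: lb_le_inf; last by move=> _ [p Ap <-]; exact: zA.
  by have [p Ap] := A0; exists (p x), p.
split=> //; split=> [x y|a x a0].
  rewrite -lerBlDr; apply: (leinf) => p1 Ap1.
  rewrite lerBlDr -lerBlDl; apply: (leinf) => p2 Ap2.
  rewrite lerBlDl; have [p Ap ple] := AD _ _ Ap1 Ap2.
  by apply: le_trans (infle p _ Ap) _.
rewrite mulrC -ler_pdivrMr//; apply: (leinf) => p Ap.
by rewrite ler_pdivrMr// mulrC; apply: le_trans (infle p _ Ap) ((Aq _ Ap).1.2 _ _ a0).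
Qed.

(** Zorn's lemma for the reverse pointwise order, a chain being bounded by its
pointwise infimum. *)
Lemma minimal_sublinear q : sublinear q ->
  exists p, [/\ sublinear p, forall x, p x <= q x &
    forall r, sublinear r -> (forall x, r x <= p x) -> r = p].
Proof.
move=> sq; pose T := {p : E -> R | sublinear p /\ forall x, p x <= q x}.
pose le_rel (s t : T) := `[< forall x, sval t x <= sval s x >].
have [||s t|A totA|[p [sp pq]] pmin] := @Zorn T le_rel.
- by move=> t; apply/asboolP.
- move=> r s t /asboolP rs /asboolP st; apply/asboolP => x.
  exact: le_trans (st x) (rs x).
- case: s t => [s Ps] [t Pt] /asboolP/= st /asboolP/= ts.
  have e : s = t by apply/funext => x; apply/le_anti; rewrite st ts.
  by subst t; rewrite (Prop_irrelevance Ps Pt).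
- have [->|/set0P [t0 At0]] := eqVneq A set0.
    by exists (exist _ q (conj sq (fun=> lexx _))) => s [].
  have [|p|p1 p2|sinf infle] := @sublinear_inf [set sval t | t in A] q.
  + by exists (sval t0), t0.
  + by move=> [t At <-]; exact: svalP t.
  + move=> [t1 At1 <-] [t2 At2 <-]; have [/asboolP h|/asboolP h] := totA _ _ At1 At2.
      exists (sval t2); first by exists t2.
      move=> x y; apply: le_trans ((svalP t2).1.1 _ _) _.
      by apply: lerD => //; exact: h.
    exists (sval t1); first by exists t1.
    move=> x y; apply: le_trans ((svalP t1).1.1 _ _) _.
    by apply: lerD => //; exact: h.
  + have infq x : inf [set p x | p in [set sval t | t in A]] <= q x.
      apply: le_trans ((svalP t0).2 x); apply: (infle); by exists t0.
    exists (exist _ (fun x => inf _) (conj sinf infq)) => s As; apply/asboolP => x /=.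
    by apply: (infle); exists s.
- exists p; split=> // r sr rp.
  have rq x : r x <= q x by exact: le_trans (rp x) (pq x).
  have := pmin (exist _ r (conj sr rq)); rewrite /le_rel/= => h.
  by have /(congr1 sval) := h (asboolT rp).
Qed.

(** For fixed y, the infimum over t >= 0 of p (x + t y) - t p y is a sublinear
function of x below p, so it equals p by minimality; the term t = 1 then gives
p x <= p (x + y) - p y. *)
Lemma minimal_sublinear_additive p : sublinear p ->
  (forall r, sublinear r -> (forall x, r x <= p x) -> r = p) ->
  forall x y, p (x + y) = p x + p y.
Proof.
move=> sp pmin x y.
pose g (t : R) x := p (x + t *: y) - t * p y.
pose A := [set g t | t in [set t | 0 <= t]].
pose py x := inf [set f x | f in A].
have gE t z : g t z = p (z + t *: y) - t * p y by [].
have lbA z : has_lbound [set f z | f in A].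
  exists (- p (- z)) => _ [_ [t /= t0 <-] <-]; rewrite gE -(sublinearZ y sp t0).
  rewrite lerBrDr -lerBrDl opprK addrC.
  by rewrite -{1}[t *: y](addKr z) [p (- z) + _]addrC addrC; exact: sp.1.
have pyle t z : 0 <= t -> py z <= g t z.
  by move=> t0; apply: ge_inf => //; exists (g t) => //; exists t.
have lepy z c : (forall t, 0 <= t -> c <= g t z) -> c <= py z.
  move=> cA; apply: lb_le_inf; last by move=> _ [_ [t t0 <-] <-]; exact: cA.
  by exists (g 0 z), (g 0) => //; exists 0 => /=.
have spy : sublinear py.
  split=> [z w|a z a0].
    rewrite -lerBlDr; apply: (lepy) => s s0; rewrite lerBlDr -lerBlDl.
    apply: (lepy) => t t0; rewrite lerBlDl.
    apply: le_trans (pyle (s + t) _ (addr_ge0 s0 t0)) _.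
    have := sp.1 (z + s *: y) (w + t *: y).
    by rewrite !gE addrACA -scalerDl; lra.
  rewrite mulrC -ler_pdivrMr//; apply: (lepy) => t t0.
  rewrite ler_pdivrMr// mulrC.
  apply: le_trans (pyle (a * t) _ (mulr_ge0 (ltW a0) t0)) _.
  by rewrite !gE -scalerA -scalerDr mulrBr mulrA lerD2r; exact: sp.2.
have pyp : py = p.
  apply: (pmin) => // z; apply: le_trans (pyle 0 z (lexx _)) _.
  by rewrite gE scale0r mul0r addr0 subr0.
apply/le_anti; rewrite sp.1/= -lerBrDr -pyp -[leRHS]/(py (x + y) - py y) pyp.
have := pyle 1 x ler01; rewrite gE scale1r mul1r.
by rewrite pyp.
Qed.

(** A minimal sublinear functional is linear, so no extension of partially defined
functionals is needed. *)
Lemma hahn_banach q : sublinear q ->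
  exists L : {linear E -> R^o}, forall x, (L x : R) <= q x.
Proof.
move=> /minimal_sublinear[p [sp pq pmin]].
have pD := minimal_sublinear_additive sp pmin.
have pN x : p (- x) = - p x.
  by apply/eqP; rewrite -addr_eq0 -pD addNr sublinear0.
pose L : E -> R^o := p; have lL : linear L.
  move=> a x y; rewrite /L pD; congr (_ + _); have [a0|a0] := leP 0 a.
    exact: sublinearZ.
  rewrite -[a]opprK scaleNr pN sublinearZ//; last by rewrite oppr_ge0 ltW.
  by rewrite [in RHS]scaleNr.
pose LL : {linear E -> R^o} := HB.pack L (GRing.isLinear.Build _ _ _ _ _ lL).
by exists LL.
Qed.

End HahnBanach.

(** * Subgradients of convex functions bounded above near the origin *)

(** The convex function is given by a convex set G playing the role of its
epigraph, which spares infinite values; P bounds the value at 0 from below. *)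
Section Subgradient.
Context {R : realType} {E : normedModType R}.
Variables (G : E -> R -> Prop) (P M eps : R).

Hypothesis G_convex : forall t x y r s, 0 <= t <= 1 -> G x r -> G y s ->
  G (t *: x + (1 - t) *: y) (t * r + (1 - t) * s).
Hypothesis G_ge : forall r, G 0 r -> P <= r.
Hypothesis eps_gt0 : 0 < eps.
Hypothesis G_ball : forall x, `|x| <= eps -> G x M.

(** Slopes (r - P) / t of the points (t x, r) of G with t > 0. When P is the value
at 0, their infimum is the directional derivative at 0 along x. *)
Let slope (x : E) : set R := [set c | exists2 t, 0 < t & G (t *: x) (P + t * c)].

(** The weights t / (s + t) and s / (s + t) make the two points s x and t y
combine to a multiple of x + y. *)
Let slopeD x y c d : slope x c -> slope y d -> slope (x + y) (c + d).
Proof.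
move=> [s s0 Gs] [t t0 Gt]; have st0 : 0 < s + t by exact: addr_gt0.
have stN0 : s + t != 0 by exact: lt0r_neq0.
have w01 : 0 <= t / (s + t) <= 1.
  apply/andP; split; first by rewrite divr_ge0// ltW.
  by rewrite ler_pdivrMr// mul1r lerDr ltW.
exists (s * t / (s + t)); first by rewrite divr_gt0// mulr_gt0.
have := G_convex w01 Gs Gt.
have -> : 1 - t / (s + t) = s / (s + t) by field.
rewrite !scalerA [t / _ * s]mulrAC [t * s]mulrC.
rewrite [s / _ * t]mulrAC -scalerDr.
by have -> : t / (s + t) * (P + s * c) + s / (s + t) * (P + t * d) =
          P + s * t / (s + t) * (c + d) by field.
Qed.

Let slope0 c : slope 0 c -> 0 <= c.
Proof.
by move=> [t t0]; rewrite scaler0 => /G_ge; rewrite lerDl pmulr_rge0.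
Qed.

(** The step eps / m moves x into the ball where G is bounded by M. *)
Let slope_norm x m : 0 < m -> `|x| <= m -> slope x ((M - P) / eps * m).
Proof.
move=> m0 xm; exists (eps / m); first exact: divr_gt0.
have -> : P + eps / m * ((M - P) / eps * m) = M.
  by field; rewrite !lt0r_neq0.
apply: G_ball; rewrite normrZ gtr0_norm ?divr_gt0// mulrAC ler_pdivrMr//.
by rewrite ler_pM2l.
Qed.

Let slope_nonempty x : slope x !=set0.
Proof.
exists ((M - P) / eps * (`|x| + 1)); apply: slope_norm.
  by rewrite ltr_wpDl.
by rewrite lerDl.
Qed.

Let inf_slope_le x c : slope x c -> inf (slope x) <= c.
Proof.
move=> xc; apply: ge_inf => //; have [d Nxd] := slope_nonempty (- x).
exists (- d) => e xe; rewrite -subr_ge0 opprK; apply: slope0.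
by rewrite -(subrr x); exact: slopeD.
Qed.

Let sublinear_slope : sublinear (fun x => inf (slope x)).
Proof.
split=> [x y|a x a0].
  rewrite -lerBlDr; apply: lb_le_inf => // c xc.
  rewrite lerBlDr -lerBlDl; apply: lb_le_inf => // d yd.
  by rewrite lerBlDl; apply: inf_slope_le; exact: slopeD.
rewrite mulrC -ler_pdivrMr//; apply: lb_le_inf => // c [t t0 Gc].
rewrite ler_pdivrMr//; apply: inf_slope_le.
exists (t / a); first exact: divr_gt0.
rewrite scalerA divfK ?lt0r_neq0//.
by have -> : t / a * (c * a) = t * c by field; rewrite lt0r_neq0.
Qed.

(** The infimum of the slopes is sublinear, and a linear functional below it is a
subgradient because r - P is a slope at x whenever G x r. It is continuous since
the infimum is at most (M - P) / eps times the norm. *)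
Lemma convex_subgradient :
  exists L : dual E, forall x r, G x r -> P + (L x : R) <= r.
Proof.
have [L Lq] := hahn_banach sublinear_slope.
have K0 : 0 <= (M - P) / eps.
  apply: divr_ge0 (ltW eps_gt0); rewrite subr_ge0.
  by apply/G_ge/G_ball; rewrite normr0 ltW.
have Lle x : (L x : R) <= (M - P) / eps * `|x|.
  have [->|x0] := eqVneq x 0; first by rewrite linear0 normr0 mulr0.
  apply: le_trans (Lq x) _; apply: inf_slope_le; apply: slope_norm => //.
  by rewrite normr_gt0.
have Lc : continuous L.
  apply/linear_bounded_continuous/linear_boundedP; near=> r => x.
  have Lr y : (L y : R) <= r * `|y|.
    by apply: le_trans (Lle y) _; rewrite ler_wpM2r.
  change (`|L x : R| <= r * `|x|); rewrite ler_norml lerNl Lr andbT.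
  by rewrite -[`|x|]normrN -(linearN L) Lr.
have LP : boundedLinear_pred (L : E -> R^o).
  by apply/asboolP; split=> //; exact: linearP.
exists (BoundedLinear LP) => x r Gxr; rewrite -lerBrDl.
apply: le_trans (Lq x) _; apply: inf_slope_le; exists 1 => //.
by rewrite scale1r mul1r addrC subrK.
Unshelve. all: by end_near. Qed.

End Subgradient.

(** * Norm estimates in the dual lattices *)

Section NormEstimates.
Context {R : realType}.

Lemma ge0_dual_homo (W : normedLatticeType R) (mu : dual W) (y z : W) :
  0 ≤ mu -> y ≤ z -> (mu y : R) <= mu z.
Proof. by move=> mu0 /subv_ge0/mu0; rewrite boundedLinear0E linearB subr_ge0. Qed.

(** The norm of a positive operator is determined on nonnegative vectors, because
|S x| <= S |x| <= T |x|. *)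
Lemma op_interval_norm (X Y : normedLatticeType R) (S T : boundedLinear X Y) :
  op_le 0 S -> op_le S T -> `|S| <= `|T|.
Proof.
move=> S0 ST; apply: opnorm_le => x x1.
have Sabs : absv (S x) ≤ S (absv x).
  apply/joinvP; split; apply/subv_ge0.
    by rewrite -(linearB S); apply/S0/subv_ge0; exact: absv_lb.
  by rewrite -(linearN S) -(linearB S); apply/S0/subv_ge0; exact: absv_lbN.
have := ler_opnorm T (absv x); rewrite norm_absv => Tx.
apply: (@le_trans _ _ (`|T (absv x)|)); last first.
  by apply: le_trans Tx _; rewrite ler_piMr// opnorm_ge0.
rewrite -norm_absv; apply: lev_norm_ge0; first exact: absv_ge0.
by apply: lev_trans Sabs _; apply: ST; exact: absv_ge0.
Qed.

Lemma weakstar_eval_continuous (V : normedModType R) (x : V) :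
  continuous (fun p : weakstar V => (p : dual V) x : R^o).
Proof.
pose i : weakstar V -> {ptws V -> R^o} := fun p => (p : dual V) : V -> R^o.
have ci : continuous i by exact: initial_continuous.
have cx : continuous (fun h : {ptws V -> R^o} => h x).
  exact: (@proj_continuous V (fun=> R^o) x).
by move=> p; exact: (continuous_comp (ci p) (cx _)).
Qed.

(** If the values at some x were unbounded on S, a sequence p_k in S with
|p_k x| > k would have no weak* convergent subsequence. So S is pointwise bounded,
and the Banach-Steinhaus theorem applies. *)
Lemma seq_compact_weakstar_bounded (V : completeNormedModType R)
    (S : set (weakstar V)) :
  seq_compact S -> exists M : R, forall p : dual V, S p -> `|p| <= M.
Proof.
move=> Scpt.
pose F := [set (p : V -> R^o) | p in (S : set (dual V))].
have [|x|M FM] := @Banach_Steinhauss R V R^o F _ _ 1.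
- move=> _ [p Sp <-]; split; last exact: boundedLinear_linear.
  move=> r; exists (opnorm p * r) => x xr.
  by apply: le_trans (ler_opnorm p x) _; rewrite ler_wpM2l// opnorm_ge0.
- apply: contrapT => /forallNP unb.
  have /choice[p pP] : forall k : nat, exists p : dual V, S p /\ k%:R < `|p x|.
    move=> k; have /existsNP[_ /not_implyP[[p Sp <-]]] := unb k%:R.
    by move=> /negP; rewrite -ltNge => h; exists p.
  have [s s_incr [l Sl pl]] := Scpt p (fun k => (pP k).1).
  have : (p (s k) x : R^o) @[k --> \oo] --> ((l : dual V) x : R^o).
    exact: (cvg_comp _ _ pl (@weakstar_eval_continuous V x l)).
  move=> /cvg_norm/cvgP/cvg_seq_bounded/bounded_fun_has_ubound[B Bub].
  have s_ge k : (k <= s k)%N.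
    by elim: k => // k IH; apply: leq_ltn_trans IH (s_incr _ _ _).
  have /= := Bub _ (imageT _ (Num.truncn B).+1); apply/negP; rewrite -ltNge.
  apply: le_lt_trans (pP (s (Num.truncn B).+1)).2.
  by apply: (le_trans (ltW (truncnS_gt B))); rewrite ler_nat.
- exists M => p Sp; apply: opnorm_le => x x1; apply: FM => //.
  by exists p.
Qed.

End NormEstimates.

(** * Strong duality for the regularised problem *)

Section Duality.
Context {R : realType} {X Y : normedLatticeType R}.

Lemma adjoint_opE_apply (mu : dual Y * dual Y) (y : Y) :
  (adjoint (@opE R Y) (dual_pair mu) y : R) = mu.1 y - mu.2 y.
Proof. by rewrite /= linearN. Qed.

Lemma adjoint_opBn_apply (S T : boundedLinear X Y) (mu : dual Y * dual Y) (x : X) :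
  (adjoint (opBn S T) (dual_pair mu) x : R) = mu.1 (S x) - mu.2 (T x).
Proof. by rewrite /= linearN. Qed.

Lemma conjugate_leP (V : normedModType R) (F : V -> \bar R) (p : dual V) (c : R) :
  (forall w, (0 <= F w)%E) ->
  (conjugate F p <= c%:E)%E <->
  (forall w a, F w = a%:E -> (p w : R) - a <= c).
Proof.
move=> F0; split=> [pc w a Fw|pc].
  rewrite -lee_fin; apply: le_trans pc; apply: ereal_sup_ubound.
  by exists w => //; rewrite Fw EFinB.
apply: ge_ereal_sup => _ [w _ <-]; have := F0 w.
case Fw : (F w) => [a| |] // _; last by rewrite addeNy leNye.
by rewrite -EFinB lee_fin; exact: pc.
Qed.

Lemma effdom_EFin (T : Type) (F : T -> \bar R) (x : T) :
  (0 <= F x)%E -> effdom F x -> exists a, F x = a%:E.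
Proof. by rewrite /effdom/=; case: (F x) => // a _ _; exists a. Qed.

Variables (J : X -> \bar R) (H : Y -> Y -> \bar R) (f : Y).
Variables (Al Au : boundedLinear X Y) (alpha : R).
Hypotheses (J_ge0 : forall w, (0 <= J w)%E) (H_ge0 : forall y, (0 <= H y f)%E).
Hypotheses (J_convex : convex_efun J) (H_convex : convex_efun (H ^~ f)).
Hypothesis alpha_gt0 : 0 < alpha.

Definition lagrangian_ge (c : R) (mu : dual Y * dual Y) : Prop :=
  forall u v a b, J u = a%:E -> H v f = b%:E ->
  c <= alpha^-1 * b + a + (mu.1 (Al u) - mu.2 (Au u)) - (mu.1 v - mu.2 v).

(** The Lagrangian separates into a part in u and a part in v, whose infima are the
two conjugates in the dual objective. Points outside the effective domains do not
affect them, so real values suffice. *)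
Lemma dual_objective_geP (mu : dual Y * dual Y) (c : R) :
  effdom J !=set0 -> effdom (H ^~ f) !=set0 ->
  (c%:E <= dual_objective H J f Al Au alpha mu)%E <-> lagrangian_ge c mu.
Proof.
move=> [u0 Ju0] [v0 Hv0].
rewrite /dual_objective; set pB := - adjoint _ _; set pE := alpha *: _.
have pBE w : (pB w : R) = - (mu.1 (Al w) - mu.2 (Au w)).
  by rewrite /pB boundedLinearNE adjoint_opBn_apply.
have pEE w : (pE w : R) = alpha * (mu.1 w - mu.2 w).
  by rewrite /pE boundedLinearZE -adjoint_opE_apply.
have [a0 Ja0] : exists a, J u0 = a%:E.
  exact: effdom_EFin Ju0.
have [b0 Hb0] : exists b, H v0 f = b%:E.
  exact: (effdom_EFin (F := H ^~ f)) Hv0.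
have geJ u a : J u = a%:E -> (((pB u : R) - a)%:E <= conjugate J pB)%E.
  move=> Ja; apply: ereal_sup_ubound; exists u => //.
  by rewrite Ja EFinB.
have geH v b : H v f = b%:E -> (((pE v : R) - b)%:E <= conjugate (H ^~ f) pE)%E.
  move=> Hb; apply: ereal_sup_ubound; exists v => //.
  by rewrite Hb EFinB.
have ai0 : 0 < alpha^-1 by rewrite invr_gt0.
split=> [cD u v a b Ja Hb|cL].
  move: cD (geJ _ _ Ja) (geH _ _ Hb).
  case: (conjugate J pB) => [j| |] //; case: (conjugate _ pE) => [h| |] //.
  - rewrite -EFinM -EFinN -EFinB !lee_fin pBE pEE => cD hj hh.
    have := ler_wpM2l (ltW ai0) hh; rewrite mulrBr mulKf ?lt0r_neq0//.
    by lra.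
  - by rewrite gt0_muley ?lte_fin.
  - by rewrite gt0_muley ?lte_fin.
have Hle u a : J u = a%:E -> (conjugate (H ^~ f) pE <=
    (alpha * (a + (mu.1 (Al u) - mu.2 (Au u)) - c))%:E)%E.
  move=> Ja; apply/conjugate_leP => // v b Hb; rewrite pEE.
  have := ler_wpM2l (ltW alpha_gt0) (cL u v a b Ja Hb).
  rewrite !mulrBr mulrDr mulrDr mulVKf ?lt0r_neq0//.
  by lra.
have [h hE] : exists h, conjugate (H ^~ f) pE = h%:E.
  move: (Hle _ _ Ja0) (geH _ _ Hb0).
  by case: (conjugate _ pE) => // h; exists h.
have Jle : (conjugate J pB <= (- c - alpha^-1 * h)%:E)%E.
  apply/conjugate_leP => // u a Ja; rewrite pBE.
  have := Hle _ _ Ja; rewrite hE lee_fin => hle.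
  have := ler_wpM2l (ltW ai0) hle; rewrite mulKf ?lt0r_neq0//.
  by lra.
rewrite hE; move: Jle (geJ _ _ Ja0); case: (conjugate J pB) => // j.
by rewrite -EFinM -EFinN -EFinB !lee_fin; lra.
Qed.

(** Epigraph of the value function of the primal problem whose two constraints
are relaxed by y, up to attainment of the infimum. *)
Definition relaxed_epigraph (y : Y * Y) (r : R) : Prop :=
  exists u v a b,
    [/\ (J u <= a%:E)%E, (H v f <= b%:E)%E, alpha^-1 * b + a <= r,
        (Al u - v) ≤ y.1 & (v - Au u) ≤ y.2].

Lemma lev_convex (t : R) (x y x' y' : Y) : 0 <= t <= 1 ->
  x ≤ y -> x' ≤ y' -> (t *: x + (1 - t) *: x') ≤ (t *: y + (1 - t) *: y').
Proof.
move=> /andP[t0 t1] xy xy'; apply: lev_add; apply/subv_ge0;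
  rewrite -scalerBr; apply: scalev_ge0; rewrite ?subr_ge0//; exact/subv_ge0.
Qed.

Lemma relaxed_epigraph_convex t (x y : Y * Y) r s : 0 <= t <= 1 ->
  relaxed_epigraph x r -> relaxed_epigraph y s ->
  relaxed_epigraph (t *: x + (1 - t) *: y) (t * r + (1 - t) * s).
Proof.
move=> t01 [u [v [a [b [Ja Hb abr c1 c2]]]]] [u' [v' [a' [b' [Ja' Hb' abr' c1' c2']]]]].
have /andP[t0 t1] := t01; have t1' : 0 <= 1 - t by rewrite subr_ge0.
have mixE (F : \bar R) (F' : \bar R) (p q : R) : (F <= p%:E -> F' <= q%:E ->
    t%:E * F + (1 - t)%:E * F' <= (t * p + (1 - t) * q)%:E)%E.
  by move=> Fp Fq; rewrite [leRHS]EFinD !EFinM; apply: leeD; apply: lee_wpmul2l.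
have mixL (S : boundedLinear X Y) :
    S (t *: u + (1 - t) *: u') = t *: S u + (1 - t) *: S u'.
  by rewrite (linearD S) 2!(linearZ_LR S).
exists (t *: u + (1 - t) *: u'), (t *: v + (1 - t) *: v').
exists (t * a + (1 - t) * a'), (t * b + (1 - t) * b'); split.
- exact: le_trans (J_convex _ _ t01) (mixE _ _ _ _ Ja Ja').
- exact: le_trans (H_convex _ _ t01) (mixE _ _ _ _ Hb Hb').
- have := ler_wpM2l t0 abr; have := ler_wpM2l t1' abr'; lra.
- have := lev_convex t01 c1 c1'; congr lev.
  by rewrite mixL opprD addrACA -!scalerBr.
- have := lev_convex t01 c2 c2'; congr lev.
  by rewrite mixL opprD addrACA -!scalerBr.
Qed.

Lemma lattice_unit_ball (one y : Y) (eps : R) : lattice_unit one -> 0 < eps ->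
  `|y| <= eps -> (- (eps *: one)) ≤ y.
Proof.
move=> [_ _ one_ub] eps0 yeps.
have : absv (eps^-1 *: y) ≤ one.
  apply: one_ub; rewrite normrZ gtr0_norm ?invr_gt0//.
  by rewrite mulrC ler_pdivrMr// mul1r.
move=> /joinvP[_ /subv_ge0]; rewrite opprK => h.
have := scalev_ge0 _ _ (ltW eps0) h.
rewrite scalerDr scalerA mulfV ?lt0r_neq0// scale1r => {}h.
by apply/subv_ge0; rewrite opprK addrC.
Qed.

(** The multiplier is the opposite of a subgradient at 0 of the value function. It
is nonnegative because relaxing the constraints cannot increase the value. *)
Lemma slater_multiplier (one : Y) (u1 : X) (v1 : Y) (a1 b1 : R) :
  lattice_unit one -> slater_condition H J f Al Au one ->
  primal_solution H J f Al Au alpha u1 v1 -> J u1 = a1%:E -> H v1 f = b1%:E ->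
  exists2 mu : dual Y * dual Y, nonneg_pair mu &
    lagrangian_ge (alpha^-1 * b1 + a1) mu.
Proof.
move=> one_unit [u0 [v0 [eps [Ju0 Hv0 eps0 c1 c2]]]] [[feas1 feas2] uv_min] Ja1 Hb1.
set P := alpha^-1 * b1 + a1.
have ai0 : 0 <= alpha^-1 by rewrite invr_ge0 ltW.
have [a0 Ja0] : exists a, J u0 = a%:E.
  exact: effdom_EFin Ju0.
have [b0 Hb0] : exists b, H v0 f = b%:E.
  exact: (effdom_EFin (F := H ^~ f)) Hv0.
have G_ge r : relaxed_epigraph 0 r -> P <= r.
  move=> [u [v [a [b [Ja Hb abr e1 e2]]]]].
  have feas : primal_feasible Al Au u v.
    split; apply/subv_ge0; first by rewrite -oppr0 -opprB; apply/lev_opp.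
    by rewrite -oppr0 -opprB; apply/lev_opp.
  have := uv_min _ _ feas; rewrite /primal_objective Ja1 Hb1 => h.
  rewrite -lee_fin EFinD EFinM; apply: le_trans h _.
  rewrite -lee_fin in abr; apply: le_trans abr; rewrite EFinD EFinM.
  by apply: leeD => //; apply: lee_wpmul2l.
have G_ball (y : Y * Y) : `|y| <= eps -> relaxed_epigraph y (alpha^-1 * b0 + a0).
  rewrite prod_normE ge_max => /andP[y1 y2]; exists u0, v0, a0, b0; split => //.
  - by rewrite Ja0.
  - by rewrite Hb0.
  - apply: lev_trans (lattice_unit_ball one_unit eps0 y1); apply/subv_ge0.
    by move/subv_ge0 : c1; congr lev; rewrite opprB opprD addrA [RHS]addrC.
  - apply: lev_trans (lattice_unit_ball one_unit eps0 y2); apply/subv_ge0.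
    by move/subv_ge0 : c2; congr lev; rewrite opprB addrAC [RHS]addrC.
have [L LP] := convex_subgradient relaxed_epigraph_convex G_ge eps0 G_ball.
pose mu : dual Y * dual Y := (- adjoint (pairop (idop Y) 0) L, - adjoint (pairop 0 (idop Y)) L).
have mu1E y : (mu.1 y : R) = - (L (y, 0) : R) by [].
have mu2E y : (mu.2 y : R) = - (L (0, y) : R) by [].
have LE y1 y2 : (L (y1, y2) : R) = - mu.1 y1 - mu.2 y2.
  rewrite mu1E mu2E !opprK.
  have -> : (y1, y2) = (y1, 0) + (0, y2) :> Y * Y by congr pair; rewrite /= ?addr0 ?add0r.
  by rewrite linearD.
have slack1 : (Al u1 - v1) ≤ 0 by rewrite -oppr0 -opprB; apply/lev_opp/subv_ge0.
have slack2 : (v1 - Au u1) ≤ 0 by rewrite -oppr0 -opprB; apply/lev_opp/subv_ge0.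
have slack y1 y2 : 0 ≤ y1 -> 0 ≤ y2 -> (L (y1, y2) : R) <= 0.
  move=> y10 y20; rewrite -(lerD2l P) addr0; apply: LP.
  exists u1, v1, a1, b1; rewrite Ja1 Hb1; split=> //; exact: lev_trans y10 || exact: lev_trans y20.
have mu_ge0 : dual_le 0 mu.1 /\ dual_le 0 mu.2.
  split=> y y0; rewrite boundedLinear0E ?mu1E ?mu2E oppr_ge0; apply: slack => //;
  exact: lev_refl.
exists mu; first exact: mu_ge0.
move=> u v a b Ja Hb.
have /LP : relaxed_epigraph (Al u - v, v - Au u) (alpha^-1 * b + a).
  by exists u, v, a, b; rewrite Ja Hb; split=> //; exact: lev_refl.
by rewrite LE !linearB/=; lra.
Qed.

(** A multiplier attains the primal value, which bounds the dual objective by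
feasibility of (u1, v1). Hence all dual solutions have this value. *)
Lemma strong_duality (one : Y) (u1 : X) (v1 : Y) (a1 b1 : R) :
  lattice_unit one -> slater_condition H J f Al Au one ->
  primal_solution H J f Al Au alpha u1 v1 -> J u1 = a1%:E -> H v1 f = b1%:E ->
  (exists mu, dual_solution H J f Al Au alpha mu) /\
  (forall mu, dual_solution H J f Al Au alpha mu ->
    lagrangian_ge (alpha^-1 * b1 + a1) mu).
Proof.
move=> one_unit slater uv_sol Ja1 Hb1.
have domJ : effdom J !=set0 by exists u1; rewrite /effdom/= Ja1 ltry.
have domH : effdom (H ^~ f) !=set0 by exists v1; rewrite /effdom/= Hb1 ltry.
have [mu mu0 mu_ge] := slater_multiplier one_unit slater uv_sol Ja1 Hb1.
have /(dual_objective_geP mu _ domJ domH) Dmu := mu_ge.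
split; last first.
  move=> mu' [_ /(_ _ mu0) mu'_max]; apply/(dual_objective_geP _ _ domJ domH).
  exact: le_trans Dmu mu'_max.
exists mu; split=> // mu' [mu'1 mu'2]; apply: le_trans Dmu.
have [[feas1 feas2] _] := uv_sol.
have D_le c : (c%:E <= dual_objective H J f Al Au alpha mu')%E ->
    c <= alpha^-1 * b1 + a1.
  move=> /(dual_objective_geP _ _ domJ domH)/(_ _ _ _ _ Ja1 Hb1).
  by have := ge0_dual_homo mu'1 feas1; have := ge0_dual_homo mu'2 feas2; lra.
move: D_le; case: (dual_objective _ _ _ _ _ _ _) => [d| |] D_le.
- by rewrite lee_fin D_le.
- exfalso; have := D_le (alpha^-1 * b1 + a1 + 1).
  by rewrite leey => /(_ isT); lra.
- exact: leNye.
Qed.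

End Duality.

(** * The cost of replacing A u by v *)

Section Gap.
Context {R : realType} {X Y : normedLatticeType R}.
Implicit Types (A S T : boundedLinear X Y) (mu : dual Y * dual Y).

(** The constraints give A u - v <= (A - S) u and v - A u <= (T - A) u, and both
differences are positive operators below T - S. *)
Lemma opB_gap A S T mu (u : X) (v : Y) :
  nonneg_pair mu -> op_le S A -> op_le A T -> primal_feasible S T u v ->
  mu.1 (A u - v) - mu.2 (A u - v) <=
    (`|mu.1| + `|mu.2|) * `|u| * `|T - S| :> R.
Proof.
move=> [mu1 mu2] SA AT [Suv vTu].
have bound (nu : dual Y) (D : boundedLinear X Y) :
    op_le 0 D -> op_le D (T - S) -> (nu (D u) : R) <= `|nu| * `|u| * `|T - S|.
  move=> D0 DT; apply: le_trans (ler_norm _) _.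
  apply: le_trans (ler_opnorm nu _) _; rewrite -mulrA ler_wpM2l ?opnorm_ge0//.
  apply: le_trans (ler_opnorm D _) _; rewrite mulrC ler_wpM2l//.
  exact: op_interval_norm.
have b1 : (mu.1 (A u - v) : R) <= `|mu.1| * `|u| * `|T - S|.
  apply: (le_trans (ge0_dual_homo (z := (A - S) u) mu1 _)).
    by apply: lev_add2l; apply/lev_opp.
  apply: bound => w w0; first by apply/subv_ge0; exact: SA.
  by apply: lev_addr; exact: AT.
have b2 : - (mu.2 (A u - v) : R) <= `|mu.2| * `|u| * `|T - S|.
  rewrite -(linearN mu.2) opprB.
  apply: (le_trans (ge0_dual_homo (z := (T - A) u) mu2 _)).
    exact: lev_addr.
  apply: bound => w w0; first by apply/subv_ge0; exact: AT.
  by apply: lev_add2l; apply/lev_opp; exact: SA.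
by have := lerD b1 b2; rewrite !mulrDl.
Qed.

End Gap.

(** * Convergence rates under the discrepancy principle *)

Theorem theorem4p10 (R : realType) (U V : banachLatticeType R)
    (J : dual U -> \bar R) (H : dual V -> dual V -> \bar R)
    (A : boundedLinear (dual U) (dual V))
    (Al Au : nat -> boundedLinear (dual U) (dual V))
    (fbar : dual V) (f : nat -> dual V) (delta eta : nat -> R) (tau : R)
    (udag : dual U) (mudag : dual (dual V) * dual (dual V))
    (u : nat -> R -> dual U) (v : nat -> R -> dual V) (alpha : nat -> R)
  (* standing assumptions on A, the data and the J-minimizing solution *)
  (A_regular : regular_op A)
  (delta_gt0 : forall n, 0 < delta n)
  (tau_gt1 : 1 < tau)
  (udag_ge0 : 0 ≤ udag)
  (udag_sol : A udag = fbar)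
  (udag_min : forall w, A w = fbar -> (J udag <= J w)%E)
  (* (i) *)
  (J_ge0 : forall w, (0 <= J w)%E)
  (J_proper : proper_fun J)
  (J_convex : convex_efun J)
  (J_lsc : lower_semicontinuous (J : weakstar U -> \bar R))
  (J_sublevel : forall c : R,
     seq_compact ([set w | (J w <= c%:E)%E] : set (weakstar U)))
  (* (ii) *)
  (H_ge0 : forall y g, (0 <= H y g)%E)
  (H_proper : proper_fun (fun yg : dual V * dual V => H yg.1 yg.2))
  (H_convex : forall g, convex_efun (H ^~ g))
  (H_lsc : lower_semicontinuous
     (fun yg : (weakstar V * weakstar V)%type => H yg.1 yg.2))
  (H_eq0 : forall y g, (H y g = 0)%E <-> y = g)
  (* (iii) *)
  (A_weakstar : continuous (A : weakstar U -> weakstar V))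
  (Al_weakstar : forall n, continuous (Al n : weakstar U -> weakstar V))
  (Au_weakstar : forall n, continuous (Au n : weakstar U -> weakstar V))
  (* (iv) *)
  (mudag_ge0 : nonneg_pair mudag)
  (source_condition :
     subdifferential J udag (- adjoint (opB A) (dual_pair mudag)))
  (* (v) *)
  (A_bounds : forall n, op_le (Al n) A /\ op_le A (Au n))
  (A_error : forall n, `|Au n - Al n| <= eta n)
  (eta_cvg0 : eta n @[n --> \oo] --> 0)
  (f_error : forall n, (H fbar (f n) <= (delta n)%:E)%E)
  (delta_cvg0 : delta n @[n --> \oo] --> 0)
  (* regularised solutions and discrepancy principle *)
  (uv_sol : forall n a, 0 < a ->
     primal_solution H J (f n) (Al n) (Au n) a (u n a) (v n a))
  (alpha_gt0 : forall n, 0 < alpha n)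
  (alpha_sup : forall n, (alpha n)%:E =
     ereal_sup [set a%:E | a in
       [set a : R | 0 < a /\ (H (v n a) (f n) <= (tau * delta n)%:E)%E]])
  (alpha_discrepancy : forall n,
     H (v n (alpha n)) (f n) = (tau * delta n)%:E) :
  let pdag := - adjoint (opB A) (dual_pair mudag) in
  exists C : R,
    (forall n,
       (bregman J pdag (u n (alpha n)) udag <=
        ((adjoint opE (dual_pair mudag) (v n (alpha n) - fbar) : R)
         + C * eta n)%:E)%E)
    /\
    (forall one : dual V, AM_space (dual V) -> lattice_unit one ->
     (forall n, slater_condition H J (f n) (Al n) (Au n) one) ->
     forall n,
       (exists mu, dual_solution H J (f n) (Al n) (Au n) (alpha n) mu) /\
       (forall mu, dual_solution H J (f n) (Al n) (Au n) (alpha n) mu ->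
          let pn := - adjoint (opBn (Al n) (Au n)) (dual_pair mu) in
          subdifferential J (u n (alpha n)) pn /\
          symm_bregman pn pdag (u n (alpha n)) udag <=
            (adjoint opE (dual_pair mudag) (v n (alpha n) - fbar) : R)
            + C * eta n)).
Proof.
move=> pdag.
have pdagE w : (pdag w : R) = - (mudag.1 (A w) - mudag.2 (A w)).
  by rewrite /pdag boundedLinearNE (adjoint_opBn_apply A A mudag w).
have [Jfin pdag_sub] := source_condition.
have Jd : J udag = (fine (J udag))%:E by rewrite fineK.
set jd := fine (J udag) in Jd.
have [M unM] := seq_compact_weakstar_bounded (J_sublevel jd).
have M0 : 0 <= M.
  by apply: le_trans (normr_ge0 udag) (unM udag _); rewrite /= Jd.
have udag_feas n : primal_feasible (Al n) (Au n) udag fbar.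
  by rewrite -udag_sol; have [lA Au_] := A_bounds n; split; [exact: lA|exact: Au_].
have Hbar n : exists2 h, H fbar (f n) = h%:E &
    (alpha n)^-1 * h <= (alpha n)^-1 * (tau * delta n).
  have := f_error n; have := H_ge0 fbar (f n).
  case: (H fbar (f n)) => // h _; rewrite lee_fin => hd; exists h => //.
  rewrite ler_pM2l ?invr_gt0//; apply: le_trans hd _.
  by rewrite ler_peMl// ltW.
have optimal n : exists2 a, J (u n (alpha n)) = a%:E & a <= jd.
  have [h hE hd] := Hbar n.
  have := (uv_sol n _ (alpha_gt0 n)).2 _ _ (udag_feas n).
  rewrite /primal_objective alpha_discrepancy hE Jd.
  have := J_ge0 (u n (alpha n)).
  case: (J (u n (alpha n))) => // a _; rewrite -!EFinM -!EFinD lee_fin => le_a.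
  by exists a => //; move: le_a hd; lra.
pose K := `|mudag.1| + `|mudag.2|.
have K0 : 0 <= K by rewrite addr_ge0// opnorm_ge0.
have pdag_gap n : - (pdag (u n (alpha n) - udag) : R) <=
    (adjoint (@opE R (dual V)) (dual_pair mudag) (v n (alpha n) - fbar) : R) +
    K * M * eta n.
  have [a aE a_le] := optimal n.
  have [lA Au_] := A_bounds n.
  have gap := opB_gap mudag_ge0 lA Au_ (uv_sol n _ (alpha_gt0 n)).1.
  have un_le : `|u n (alpha n)| <= M by apply: unM; rewrite /= aE lee_fin.
  have gap_le : K * `|u n (alpha n)| * `|Au n - Al n| <= K * M * eta n.
    by rewrite ler_pM// ?mulr_ge0//; apply: ler_wpM2l.
  have := le_trans gap gap_le.
  rewrite pdagE adjoint_opE_apply.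
  have -> : A (u n (alpha n) - udag) = A (u n (alpha n)) - fbar.
    by rewrite -udag_sol; exact: linearB.
  by rewrite !linearB/=; lra.
exists (K * M); split=> [n|one _ one_unit slater n].
  have [a aE a_le] := optimal n; rewrite /bregman aE Jd -!EFinB lee_fin.
  by have := pdag_gap n; lra.
have [a aE a_le] := optimal n; have [h hE hd] := Hbar n.
have [mu_ex mu_saddle] := strong_duality J_ge0 (fun y => H_ge0 y (f n)) J_convex
  (H_convex (f n)) (alpha_gt0 n) one_unit (slater n) (uv_sol n _ (alpha_gt0 n))
  aE (alpha_discrepancy n).
split=> // mu mu_sol pn.
have [[mu1 mu2] _] := mu_sol.
have saddle := mu_saddle mu mu_sol.
have pnB w w' : (pn (w - w') : R) = (pn w : R) - pn w' by exact: linearB.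
have pnE w : (pn w : R) = - (mu.1 (Al n w) - mu.2 (Au n w)).
  by rewrite /pn boundedLinearNE adjoint_opBn_apply.
have [[feas1 feas2] _] := uv_sol n _ (alpha_gt0 n).
have comp1 := ge0_dual_homo mu1 feas1; have comp2 := ge0_dual_homo mu2 feas2.
have [dfeas1 dfeas2] := udag_feas n.
have dcomp1 := ge0_dual_homo mu1 dfeas1; have dcomp2 := ge0_dual_homo mu2 dfeas2.
split.
  split=> [|w]; first by rewrite aE.
  have := J_ge0 w; case wE : (J w) => [b| |] // _; last by rewrite leey.
  rewrite aE -EFinD lee_fin pnB !pnE.
  (* The Lagrangian bound at (w, v_n), with v_n compared to the images of u_n. *)
  have := saddle _ _ _ _ wE (alpha_discrepancy n); lra.
have pn_le0 : (pn (u n (alpha n) - udag) : R) <= 0.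
  rewrite pnB !pnE.
  (* The Lagrangian bound at (u_n, fbar), with fbar compared to the images of
     udag through the nonnegative multipliers. *)
  have := saddle _ _ _ _ aE hE; lra.
by rewrite -[leRHS]add0r; exact: lerD pn_le0 (pdag_gap n).
Qed.
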